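(* For any integer $d \geq 2$ and any integer $n \geq d+2$, there exists an $(n,d)^{th}$ perfect set with cardinality less than or equal to $\frac{1}{2}\binom{n}{d}$.
   Context: Let $K$ be a field and $S=K[x_1,\ldots,x_n]$. For an integer $e$, $sm(S)_e$ denotes the set of square-free monomials of degree $e$ in $S$ (empty if $e<0$ or $e>n$). For $A\subseteq sm(S)_d$ put $\sqcup(A)=\{g x_i \mid g\in A,\ 1\le i\le n,\ x_i\nmid g\}\subseteq sm(S)_{d+1}$ and $\sqcap(A)=\{g/x_i \mid g\in A,\ 1\le i\le n,\ x_i\mid g\}\subseteq sm(S)_{d-1}$. The set $A$ is upper perfect if $\sqcup(A)=sm(S)_{d+1}$ (every square-free monomial of degree $d+1$ is divisible by some element of $A$), and lower perfect if $\sqcap(A)=sm(S)_{d-1}$ (every square-free monomial of degree $d-1$ divides some element of $A$). An $(n,d)^{th}$ perfect set is a subset of $sm(S)_d$ that is both upper and lower perfect. *)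

(* Defs.v *)
From mathcomp Require Import all_boot all_order all_algebra.
From mathcomp Require Import finmap.
From mathcomp Require Import boolp classical_sets.
From mathcomp Require Import mpoly.

Set Implicit Arguments.
Unset Strict Implicit.
Unset Printing Implicit Defensive.

Import Order.TTheory GRing.Theory Num.Theory.

Local Open Scope classical_set_scope.
Local Open Scope ring_scope.

Definition mpoly_dvd (K : fieldType) (n : nat) (p q : {mpoly K[n]}) : Prop :=
  exists r : {mpoly K[n]}, q = r * p.

(* The degree is an integer, so that [sm K n e] is empty for [e < 0]. *)
Definition sm (K : fieldType) (n : nat) (e : int) : set {mpoly K[n]} :=
  [set p | exists m : 'X_{1..n},
     [/\ p = 'X_[K, m], forall i : 'I_n, (m i <= 1)%N & (mdeg m)%:Z = e]].

Arguments sm K n e : clear implicits.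

Definition upper_shadow (K : fieldType) (n : nat) (A : set {mpoly K[n]}) :
    set {mpoly K[n]} :=
  [set p | exists g (i : 'I_n), [/\ A g, ~ mpoly_dvd 'X_i g & p = g * 'X_i]].

(* In the domain [{mpoly K[n]}], [g = p * 'X_i] says that ['X_i] divides [g]
   with quotient [p]. *)
Definition lower_shadow (K : fieldType) (n : nat) (A : set {mpoly K[n]}) :
    set {mpoly K[n]} :=
  [set p | exists g (i : 'I_n), A g /\ g = p * 'X_i].

Definition upper_perfect (K : fieldType) (n : nat) (d : int)
    (A : set {mpoly K[n]}) : Prop :=
  upper_shadow A = sm K n (d + 1).

Definition lower_perfect (K : fieldType) (n : nat) (d : int)
    (A : set {mpoly K[n]}) : Prop :=
  lower_shadow A = sm K n (d - 1).

Definition perfect_set (K : fieldType) (n : nat) (d : int)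
    (A : set {mpoly K[n]}) : Prop :=
  [/\ A `<=` sm K n d, upper_perfect d A & lower_perfect d A].

(* Main.v *)
(** Square-free monomials are subsets of the set of variables.  For a variable
    [x], a perfect family of [d]-sets avoiding [x] together with a perfect
    family of [(d-1)]-sets avoiding [x], each enlarged by [x], is perfect, so
    the bound propagates along Pascal's rule.  The
    recursion stops at [d = 2], where two disjoint cliques on halves of the
    variables work, and at [n = d + 2], which is the complement of [d = 2]. *)
Require Import Defs.
From mathcomp Require Import all_boot all_order all_algebra.
From mathcomp Require Import finmap.
From mathcomp Require Import boolp classical_sets.
From mathcomp Require Import mpoly zify lra.
From mathcomp Require Import fintype finset.

Set Implicit Arguments.
Unset Strict Implicit.
Unset Printing Implicit Defensive.

Import Order.TTheory GRing.Theory Num.Theory.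

(** * Perfect families of subsets of a finite set *)

Local Open Scope set_scope.

(** The ground set [V] is a parameter so that an induction can delete a point of it. Writing
    [#|S|.+1 = d] avoids truncated subtraction: at [d = 0] the last clause is vacuous, just as there
    are no monomials of degree -1. *)
Definition perfect_family (T : finType) (V : {set T}) (d : nat)
    (A : {set {set T}}) : Prop :=
  [/\ forall g, g \in A -> g \subset V /\ #|g| = d,
      forall U : {set T}, U \subset V -> #|U| = d.+1 ->
        exists2 g, g \in A & g \subset U
    & forall S : {set T}, S \subset V -> #|S|.+1 = d ->
        exists2 g, g \in A & S \subset g].

Lemma subset_of_card (T : finType) (V : {set T}) (k : nat) :
  k <= #|V| -> exists2 P : {set T}, P \subset V & #|P| = k.
Proof.
rewrite -bin_gt0 -cards_draws card_gt0 => /set0Pn[P].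
by rewrite inE => /andP[sPV /eqP cP]; exists P.
Qed.

(** Complementation in [V] reverses inclusion and turns sets of size [e + 1] and [e - 1] into sets
    of size [d - 1] and [d + 1], so the upper and lower conditions trade places. *)
Lemma perfect_family_compl (T : finType) (V : {set T}) (d e : nat)
    (A : {set {set T}}) :
  #|V| = d + e -> perfect_family V d A ->
  perfect_family V e [set V :\: g | g in A].
Proof.
move=> cV [sA upA lowA]; split.
- move=> _ /imsetP[g gA ->]; have [sgV cg] := sA g gA.
  by rewrite subsetDl; split=> //; rewrite cardsDS // cg cV addKn.
- move=> U sUV cU.
  have [|g gA sg] := lowA (V :\: U) (subsetDl _ _).
    by have := subset_leq_card sUV; rewrite cardsDS //; lia.
  exists (V :\: g); first exact: imset_f.
  by apply/subsetP=> x; rewrite inE => /andP[xg xV]; apply: contraR xg => xU;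
    apply: (subsetP sg); rewrite inE xU.
- move=> S sSV cS.
  have [|g gA sg] := upA (V :\: S) (subsetDl _ _).
    by rewrite cardsDS //; lia.
  exists (V :\: g); first exact: imset_f.
  apply/subsetP=> x xS; rewrite inE (subsetP sSV) // andbT.
  by apply/negP=> /(subsetP sg); rewrite inE xS.
Qed.

(** A test set that contains [x] is handled by [B] after deleting [x]; one that avoids [x] is
    handled by [A]. *)
Lemma perfect_family_pascal (T : finType) (V : {set T}) (x : T) (d : nat)
    (A B : {set {set T}}) :
  x \in V -> perfect_family (V :\ x) d.+1 A -> perfect_family (V :\ x) d B ->
  perfect_family V d.+1 (A :|: [set x |: g | g in B]).
Proof.
move=> xV [sA upA lowA] [sB upB lowB].
have sD (U : {set T}) : U \subset V -> x \notin U -> U \subset V :\ x.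
  by move=> sU xU; rewrite subsetD1 sU xU.
split.
- move=> g /setUP[gA|/imsetP[h hB ->]].
    have [sg cg] := sA g gA; split=> //.
    by rewrite (subset_trans sg) // subD1set.
  have [] := sB h hB; rewrite subsetD1 => /andP[sh xh] ch.
  by rewrite subUset sub1set xV sh cardsU1 xh ch.
- move=> U sU cU; have [xU|xU] := boolP (x \in U).
    have [||g gB sg] := upB (U :\ x); first exact: setSD.
      by have := cardsD1 x U; rewrite xU; lia.
    exists (x |: g); first by rewrite inE imset_f ?orbT.
    by rewrite subUset sub1set xU (subset_trans sg) // subD1set.
  have [g gA sg] := upA U (sD _ sU xU) cU.
  by exists g; rewrite ?inE ?gA.
- move=> S sS cS; have [xS|xS] := boolP (x \in S).
    have [||g gB sg] := lowB (S :\ x); first exact: setSD.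
      by have := cardsD1 x S; rewrite xS; lia.
    exists (x |: g); first by rewrite inE imset_f ?orbT.
    by rewrite -(setD1K xS) setUS.
  have [g gA sg] := lowA S (sD _ sS xS) cS.
  by exists g; rewrite ?inE ?gA.
Qed.

(** Among three points two lie in the same half, hence form an edge of its clique. Since
    [4 <= #|V|], each half has at least two points, so every point lies on an edge. *)
Lemma perfect_family_two (T : finType) (V : {set T}) :
  4 <= #|V| ->
  exists2 A, perfect_family V 2 A & 2 * #|A| <= 'C(#|V|, 2).
Proof.
move=> cV; have [|P sP cP] := @subset_of_card T V #|V|./2; first by lia.
have cQ : #|V :\: P| = #|V| - #|V|./2 by rewrite cardsDS // cP.
pose edges (W : {set T}) := [set e : {set T} | e \subset W & #|e| == 2].
exists (edges P :|: edges (V :\: P)); last first.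
  apply: (@leq_trans (2 * ('C(#|P|, 2) + 'C(#|V :\: P|, 2)))).
    by rewrite leq_mul2l /= -!cards_draws cardsU leq_subr.
  have b2 m : 'C(m, 2) * 2 = m * m.-1 by rewrite mulnC -mul_bin_diag bin1.
  rewrite cQ cP; move: #|V| => n.
  have := b2 n; have := b2 n./2; have := b2 (n - n./2).
  (* For n = 2k + 1 the bound reads 2k^2 <= k(2k + 1), and for n = 2k it reads 2k(k - 1) <= k(2k -
     1). *)
  have := odd_double_half n; case: (odd n) => /=; move: (n./2) => k <-.
    have -> : (true + k.*2 - k = k.+1)%N by lia.
    by case: k => [|k]; rewrite -?muln2 /=; nia.
  have -> : (false + k.*2 - k = k)%N by lia.
  by case: k => [|k]; rewrite -?muln2 /=; nia.
have cliqueP (W S : {set T}) : #|S| = 1 -> 2 <= #|W| -> S \subset W ->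
    exists2 e, e \in edges W & S \subset e.
  move=> /eqP/cards1P[x ->] cW; rewrite sub1set => xW.
  have /set0Pn[y] : W :\ x != set0.
    by rewrite -card_gt0; have := cardsD1 x W; rewrite xW; lia.
  rewrite in_setD1 => /andP[yx yW]; exists [set x; y]; last first.
    by rewrite sub1set !inE eqxx.
  by rewrite inE subUset !sub1set xW yW cards2 (eq_sym x) yx.
split.
- move=> g; rewrite !inE => /orP[]/andP[sg /eqP cg]; split=> //.
    exact: subset_trans sP.
  exact: subset_trans sg (subsetDl _ _).
- move=> U sU cU.
  have cUP := cardsID P U.
  have [le2|lt2] := leqP 2 #|U :&: P|.
    have [e se ce] := subset_of_card le2; exists e.
      by rewrite !inE ce (subset_trans se (subsetIr _ _)).
    exact: subset_trans se (subsetIl _ _).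
  have [|e se ce] := @subset_of_card T (U :\: P) 2; first by lia.
  exists e; last exact: subset_trans se (subsetDl _ _).
  by rewrite !inE ce (subset_trans se (setSD _ sU)) orbT.
- move=> S sS [cS]; have /eqP/cards1P[x Sx] := cS.
  have [xP|xP] := boolP (x \in P).
    have [||e eA se] := @cliqueP P S cS; [lia|by rewrite Sx sub1set|].
    by exists e; rewrite // inE eA.
  have [||e eA se] := @cliqueP (V :\: P) S cS; first by lia.
    by rewrite Sx sub1set inE xP -sub1set -Sx.
  by exists e; rewrite // inE eA orbT.
Qed.

(** Induction on [#|V|]. After deleting a point, the family of [d]-sets still meets the size
    hypothesis unless [#|V| = d + 2], and the family of [(d-1)]-sets still has degree at least 2
    unless [d = 2]; these exceptions are the base cases. *)
Lemma perfect_family_half (T : finType) (V : {set T}) (d : nat) :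
  2 <= d -> d + 2 <= #|V| ->
  exists2 A, perfect_family V d A & 2 * #|A| <= 'C(#|V|, d).
Proof.
have [m cV] : exists m, #|V| = m by exists #|V|.
elim: m => [|m IHm] in V d cV *; first by lia.
move=> d2 dV; have [d_2|d_n2] := eqVneq d 2.
  by rewrite d_2; apply: perfect_family_two; lia.
have [eV|nV] := eqVneq #|V| (d + 2).
  have [|A perfA cA] := @perfect_family_two T V; first by lia.
  exists [set V :\: g | g in A].
    by apply: perfect_family_compl perfA; lia.
  have -> : 'C(#|V|, d) = 'C(#|V|, 2) by rewrite -bin_sub eV ?addKn ?leq_addr.
  by apply: leq_trans cA; rewrite leq_mul2l leq_imset_card.
case: d => [//|d] in d2 dV d_n2 nV *.
have /set0Pn[x xV] : V != set0 by rewrite -card_gt0; lia.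
have cVx : #|V :\ x| = m by have := cardsD1 x V; rewrite xV; lia.
have [||A perfA cA] := IHm (V :\ x) d.+1 cVx; [lia|lia|].
have [||B perfB cB] := IHm (V :\ x) d cVx; [lia|lia|].
exists (A :|: [set x |: g | g in B]); first exact: perfect_family_pascal.
rewrite cV binS -cVx (leq_trans _ (leq_add cA cB)) // -mulnDr leq_mul2l /=.
by rewrite (leq_trans (leq_card_setU _ _)) // leq_add2l leq_imset_card.
Qed.

(** * Translation between sets of variables and square-free monomials *)

Local Open Scope ring_scope.

Definition sfmon (K : fieldType) (n : nat) (g : {set 'I_n}) : {mpoly K[n]} :=
  'X_[[multinom (i \in g : nat) | i < n]].

Arguments sfmon K {n} g.

Lemma smP (K : fieldType) (n : nat) (e : int) (p : {mpoly K[n]}) :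
  sm K n e p <-> exists2 g : {set 'I_n}, p = sfmon K g & #|g|%:Z = e.
Proof.
split=> [[m [-> m1 dm]]|[g -> cg]].
  exists [set i | m i == 1%N]%SET.
    congr 'X_[_]; apply/mnmP=> i; rewrite mnmE inE.
    by case: (m i) (m1 i) => [|[]].
  rewrite -dm mdegE; congr Posz; rewrite -sum1_card big_mkcond /=.
  by apply: eq_bigr => i _; rewrite inE; case: (m i) (m1 i) => [|[]].
exists [multinom (i \in g : nat) | i < n]; split=> // [i|].
  by rewrite mnmE leq_b1.
rewrite -cg mdegE; congr Posz; rewrite -sum1_card [RHS]big_mkcond /=.
by apply: eq_bigr => i _; rewrite mnmE; case: (i \in g).
Qed.

Lemma sfmonU1 (K : fieldType) (n : nat) (g : {set 'I_n}) (i : 'I_n) :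
  i \notin g -> sfmon K (i |: g) = sfmon K g * 'X_i.
Proof.
move=> ig; rewrite /sfmon -mpolyXD; congr 'X_[_]; apply/mnmP=> j.
rewrite mnmDE !mnmE !inE eq_sym.
by have [<-|_] := eqVneq i j; rewrite ?(negPf ig) ?addn0.
Qed.

Lemma mpoly_dvd_sfmon (K : fieldType) (n : nat) (g : {set 'I_n}) (i : 'I_n) :
  mpoly_dvd 'X_i (sfmon K g) <-> i \in g.
Proof.
split=> [[r eq_r]|ig]; last first.
  exists (sfmon K (g :\ i)); rewrite -sfmonU1 ?setD1K //.
  by rewrite !inE eqxx.
apply/negPn/negP=> ig.
(* Evaluate at the point whose [i]-th coordinate is 0 and whose others are 1: a multiple of ['X_i]
   vanishes there, whereas [sfmon K g] takes the value 1 when [i] is not in [g]. *)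
have := congr1 (meval (fun j => (j != i)%:R)) eq_r.
rewrite mevalM mevalXU eqxx mulr0 mevalX big1 => [/eqP|j _].
  by rewrite oner_eq0.
rewrite mnmE; have [->|] := eqVneq j i; first by rewrite (negPf ig).
by rewrite expr1n.
Qed.

(** Each shadow equality is two inclusions: a shadow consists of square-free monomials of the right
    degree, and the converse is the matching clause of [perfect_family]. *)
Lemma perfect_set_sfmon (K : fieldType) (n d : nat) (A : {set {set 'I_n}}) :
  (0 < d)%N -> perfect_family [set: 'I_n] d A ->
  perfect_set d%:Z [set` [fset sfmon K g | g in A]%fset].
Proof.
move=> d0 [sA upA lowA].
have memA p : [set` [fset sfmon K g | g in A]%fset]%classic p <->
    exists2 g, g \in A & p = sfmon K g.
  split=> [/imfsetP[g gA ->]|[g gA ->]]; first by exists g.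
  exact: in_imfset.
split.
- move=> p /memA[g gA ->]; apply/smP; exists g => //.
  by have [_ ->] := sA g gA.
- apply/seteqP; split=> p.
    move=> [_ [i [/memA[g gA ->] ig ->]]]; apply/smP.
    have {}ig : i \notin g by apply/negP=> /mpoly_dvd_sfmon.
    exists (i |: g); first by rewrite sfmonU1.
    by have [_ cg] := sA g gA; rewrite cardsU1 ig cg; lia.
  move=> /smP[U -> cU].
  have [||g gA sg] := upA U; [exact: subsetT|lia|].
  have [_ cg] := sA g gA.
  (* [U] has one element more than its subset [g]; that element is the variable to multiply by. *)
  have /cards1P[i Ui] : #|U :\: g| == 1%N by rewrite cardsDS // cg; lia.
  have /setDP[iU ig] : i \in U :\: g by rewrite Ui set11.
  exists (sfmon K g), i; split; first by apply/memA; exists g.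
    by move/mpoly_dvd_sfmon; apply/negP.
  by rewrite -sfmonU1 // setUC -Ui setDE setUIr setUCr setIT (setUidPr sg).
- apply/seteqP; split=> p.
    move=> [_ [i [/memA[g gA ->] eq_p]]]; apply/smP.
    have ig : i \in g by apply/(@mpoly_dvd_sfmon K); exists p.
    exists (g :\ i).
      (* Cancel ['X_i] coefficientwise: the coefficient of a polynomial at [m] is that of its
         product with ['X_i] at the monomial shifted by [U_(i)]. *)
      apply/mpolyP=> m; rewrite -[LHS](mcoeffMX _ U_(i)%MM).
      rewrite -[RHS](mcoeffMX _ U_(i)%MM).
      by rewrite -eq_p -sfmonU1 ?setD1K // !inE eqxx.
    by have [_ <-] := sA g gA; rewrite (cardsD1 i g) ig addnC PoszD addrK.
  move=> /smP[S -> cS].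
  have [||g gA sg] := lowA S; [exact: subsetT|lia|].
  have [_ cg] := sA g gA.
  have /cards1P[i gi] : #|g :\: S| == 1%N by rewrite cardsDS // cg; lia.
  have /setDP[ig iS] : i \in g :\: S by rewrite gi set11.
  exists (sfmon K g), i; split; first by apply/memA; exists g.
  by rewrite -sfmonU1 // setUC -gi setDE setUIr setUCr setIT (setUidPr sg).
Qed.

Local Open Scope classical_set_scope.

Theorem theorem3p9 (K : fieldType) (d n : nat)
    (hd : (2 <= d)%N) (hn : (d + 2 <= n)%N) :
  exists A : {fset {mpoly K[n]}},
    perfect_set d%:Z [set` A] /\
    (#|` A|%:R : rat) <= 1 / 2 * 'C(n, d)%:R.
Proof.
have cn : #|[set: 'I_n]%SET| = n by rewrite cardsT card_ord.
have [|A perfA cA] := @perfect_family_half _ [set: 'I_n]%SET d hd.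
  by rewrite cn.
exists [fset sfmon K g | g in A]%fset; split.
  by apply: perfect_set_sfmon => //; apply: ltn_trans hd.
have le_card : (#|` [fset sfmon K g | g in A]%fset| <= #|A|)%N.
  by rewrite (leq_trans (leq_imfset_card _ _ _)) // cardE.
have : (2 * #|` [fset sfmon K g | g in A]%fset| <= 'C(n, d))%N.
  by rewrite -[in 'C(_, _)]cn (leq_trans _ cA) // leq_mul2l.
rewrite -(ler_nat rat) natrM; lra.
Qed.
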